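(* Let $\kappa$ be an uncountable cardinal. If $\kappa \in \mathfrak{sp}(\text{Borel})$, then $\mathfrak{par}(\kappa^\omega) \in \mathfrak{sp}(\text{Borel})$.
   Context: $\mathfrak{sp}(\text{Borel}) = \{|\mathcal{P}| : \mathcal{P} \text{ is a partition of } \mathbb{R} \text{ into uncountably many Borel sets}\}$. The cardinal $\kappa$ has the discrete topology and $\kappa^\omega$ the product topology. For a topological space $X$, $\mathfrak{par}(X) = \min\{|\mathcal{P}| : \mathcal{P} \text{ is a partition of } X \text{ into Polish subspaces}\}$. *)

(* Defs.v *)
From HB Require Import structures.
From mathcomp Require Import all_boot all_order all_algebra.
From mathcomp Require Import all_classical all_reals all_analysis.

Set Implicit Arguments.
Unset Strict Implicit.
Unset Printing Implicit Defensive.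

Import Order.TTheory GRing.Theory Num.Theory.
Import numFieldNormedType.Exports.

Local Open Scope classical_set_scope.
Local Open Scope ring_scope.
Local Open Scope card_scope.

(* Cardinals are represented by sets, up to the equipotence [#=] and ordered by
   [#<=]. A partition is a set [P] of blocks (the library's indexed [partition]
   taken at the identity family), so that its cardinality is that of [P]. *)

(* [sp_Borel R A] reads |A| \in sp(Borel). *)
Definition sp_Borel (R : realType) (T : Type) (A : set T) : Prop :=
  exists P : set (set R),
    [/\ partition P id [set: R],
        P `<=` <<s @open R >>,
        ~ countable P
      & P #= A].

Definition is_metric (R : realType) (X : Type) (d : X -> X -> R) : Prop :=
  [/\ forall x y, d x y = 0 <-> x = y,
      forall x y, d x y = d y x
    & forall x y z, d x z <= d x y + d y z].

Definition metric_induces (R : realType) (X : topologicalType)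
    (d : X -> X -> R) : Prop :=
  forall U : set X, open U <->
    forall x, U x -> exists2 e : R, 0 < e & [set y | d x y < e] `<=` U.

Definition metric_cauchy_seq (R : realType) (X : Type) (d : X -> X -> R)
    (u : nat -> X) : Prop :=
  forall e : R, 0 < e ->
    exists N : nat, forall m n, (N <= m)%N -> (N <= n)%N -> d (u m) (u n) < e.

Definition metric_complete (R : realType) (X : Type) (d : X -> X -> R) : Prop :=
  forall u : nat -> X, metric_cauchy_seq d u ->
    exists x : X, forall e : R, 0 < e ->
      exists N : nat, forall n, (N <= n)%N -> d (u n) x < e.

Definition completely_metrizable (R : realType) (X : topologicalType) : Prop :=
  exists d : X -> X -> R, [/\ is_metric d, metric_induces d & metric_complete d].

Definition separable_space (X : topologicalType) : Prop :=
  exists2 D : set X, countable D & dense D.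

Definition polish_space (R : realType) (X : topologicalType) : Prop :=
  separable_space X /\ completely_metrizable R X.

(* The block [A] is coerced to the subtype of its elements, whose topology is
   the subspace topology (unlike the library's [subspace A]). *)
Definition polish_partition (R : realType) (X : topologicalType)
    (P : set (set X)) : Prop :=
  partition P id [set: X] /\ forall A : set X, P A -> polish_space R A.

Definition min_polish_partition (R : realType) (X : topologicalType)
    (P : set (set X)) : Prop :=
  polish_partition R P /\
  forall Q : set (set X), polish_partition R Q -> P #<= Q.

(* The cardinal par(X), represented by a chosen partition of least cardinality;
   [parP] shows that there is one. *)
Definition par (R : realType) (X : topologicalType) : set (set X) :=
  [get P | @min_polish_partition R X P].
Arguments par : clear implicits.

Lemma card_le_wf (T : pointedType) (S : set (set T)) :
  S !=set0 -> exists2 P, S P & forall Q, S Q -> P #<= Q.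
Proof.
move=> [Q0 SQ0].
pose Z := [set M : set (set T -> T) |
  (forall f Q, M f -> S Q -> Q (f Q)) /\
  (forall f g Q, M f -> M g -> S Q -> f Q = g Q -> f = g)].
have [|M [[ZM1 ZM2] Mmax]] := @Zorn_bigcup _ Z.
  move=> F FZ Ftot; split=> [f Q [M FM Mf] SQ|f g Q [M FM Mf] [N FN Ng] SQ fg].
    by have [FZ1 _] := FZ _ FM; exact: (FZ1 f Q Mf SQ).
  have [MN|NM] := Ftot _ _ FM FN.
    by have [_ FZ2] := FZ _ FN; exact: (FZ2 f g Q (MN _ Mf) Ng SQ fg).
  by have [_ FZ2] := FZ _ FM; exact: (FZ2 f g Q Mf (NM _ Ng) SQ fg).
have [[P SP PM]|noP] :=
    pselect (exists2 P, S P & P `<=` [set f P | f in M]).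
  exists P => // Q SQ.
  apply: (card_le_trans (subset_card_le PM)).
  apply: (card_le_trans (card_image_le _ _)).
  have inj : {in M &, injective (fun f : set T -> T => f Q)}.
    by move=> f g /set_mem Mf /set_mem Mg; exact: (ZM2 f g Q Mf Mg SQ).
  have := inj_card_eq inj; rewrite card_eq_sym => /card_eqPle[MQ _].
  apply: (card_le_trans MQ); apply: subset_card_le => _ [f Mf <-].
  exact: (ZM1 f Q Mf SQ).
have /choice[a aP] : forall Q, exists x, S Q -> Q x /\ ~ [set f Q | f in M] x.
  move=> Q; have [SQ|] := pselect (S Q); last by exists point.
  apply: contrapT => nx; apply: noP; exists Q => // x Qx.
  by apply: contrapT => nMx; apply: nx; exists x.
exfalso; apply: (Mmax (M `|` [set a])).
  split; first by move=> f Mf; left.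
  move=> /(_ a (or_intror erefl)) Ma.
  by have [_] := aP _ SQ0; apply; exists a.
split=> [f Q [Mf|->] SQ|f g Q [Mf|->] [Mg|->] SQ //].
- exact: (ZM1 f Q Mf SQ).
- by have [] := aP _ SQ.
- exact: (ZM2 f g Q Mf Mg SQ).
- by move=> fa; have [_] := aP _ SQ; case; exists f.
- by move=> ag; have [_] := aP _ SQ; case; exists g.
Qed.

Lemma polish_space_set1 (R : realType) (X : topologicalType) (x : X) :
  polish_space R [set x].
Proof.
have e (a b : [set x]) : a = b.
  apply: val_inj; case: a => a /= /set_mem; case: b => b /= /set_mem.
  by move=> -> ->.
split.
  exists [set: [set x]]; last by move=> O [y Oy] _; exists y.
  apply: finite_set_countable.
  exact: sub_finite_set (finite_set1 (exist _ x (mem_set erefl))).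
exists (fun _ _ => 0); split.
- by split=> // a b; rewrite addr0.
- move=> U; split=> [_ a Ua|_].
    by exists 1 => // b _; rewrite (e b a).
  have [[a Ua]|U0] := pselect (U !=set0).
    suff -> : U = setT by exact: openT.
    by apply/seteqP; split=> // b _; rewrite (e b a).
  suff -> : U = set0 by exact: open0.
  by apply/seteqP; split=> // b Ub; apply: U0; exists b.
- move=> u _; exists (u 0%N) => r r0.
  by exists 0%N.
Qed.

Lemma parP (R : realType) (X : topologicalType) :
  min_polish_partition R (par R X).
Proof.
apply: (@getPex _ (@min_polish_partition R X)).
have [|P pP Pmin] := @card_le_wf _ [set P | @polish_partition R X P].
  exists (range set1); split; last first.
    by move=> _ [x _ <-]; exact: polish_space_set1.
  split.
  - by apply/seteqP; split=> // x _; exists [set x].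
  - by move=> _ _ [x _ <-] [y _ <-] [_ [-> ->]].
  - by move=> _ [x _ <-]; exists x.
by exists P.
Qed.

(* Main.v *)
(* Let [f : R -> K] send a real to the index of its block. Composing [f],
   coordinatewise, with a Borel surjection [R -> R^nat] gives a surjection
   [psi : R -> K^nat] such that each [psi r n = k] is a Borel condition on [r].
   A Polish subspace of [K^nat] is a countable intersection of countable unions
   of cylinders, so its preimage under [psi] is Borel, and the preimages of the
   blocks of a least Polish partition of [K^nat] partition [R]. There are
   uncountably many of them, for otherwise [K^nat] and its image [K] under a
   projection would be separable. *)
Require Import Defs.
From mathcomp Require Import all_boot all_order all_algebra.
From mathcomp Require Import all_classical all_reals all_analysis.
From mathcomp Require Import measurable_realfun zify.

Set Implicit Arguments.
Unset Strict Implicit.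
Unset Printing Implicit Defensive.

Import Order.TTheory GRing.Theory Num.Theory.
Import numFieldNormedType.Exports.

Local Open Scope classical_set_scope.
Local Open Scope ring_scope.

Section indexed_partitions.
Context {J T : Type}.
Implicit Types (D : set J) (F : J -> set T).

Lemma partition_inj D F (A : set T) :
  partition D F A -> {in D &, injective F}.
Proof.
move=> [_ tF F0] i j /set_mem Di /set_mem Dj Fij; apply: tF => //.
by rewrite Fij setIid; exact: F0.
Qed.

Lemma partition_image D F (A : set T) :
  partition D F A -> partition (F @` D) id A.
Proof.
move=> [cF tF F0]; split.
- by rewrite /cover bigcup_image.
- exact: trivIset_image.
- by move=> _ [i Di <-]; exact: F0.
Qed.

Lemma partition_preimage {U : Type} (g : U -> T) D F :
  set_surj [set: U] [set: T] g -> partition D F [set: T] ->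
  partition D (fun i => g @^-1` F i) [set: U].
Proof.
move=> gsurj [cF tF F0]; split.
- by rewrite /cover -preimage_bigcup -[X in _ @^-1` X]/(cover D F) cF.
- by move=> i j Di Dj [u [Fi Fj]]; apply: tF => //; exists (g u).
- by move=> i /F0[x Fx]; have [u _ ux] := gsurj x I; exists u; rewrite /= ux.
Qed.

End indexed_partitions.

Lemma borel_sigma_algebraE (R : realType) :
  <<s @open R >> = (measurable : set (set R)).
Proof.
apply/seteqP; split=> A.
  apply: smallest_sub; first exact: sigma_algebra_measurable.
  by move=> U /open_measurable.
rewrite [measurable](RGenOpens.measurableE R); apply: smallest_sub.
  exact: smallest_sigma_algebra.
by move=> _ [x [y ->]]; apply: sub_sigma_algebra; exact: interval_open.
Qed.

Lemma sp_Borel_surj (R : realType) (T : Type) (A : set T) :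
  sp_Borel R A -> exists2 f : R -> T, set_surj [set: R] A f &
    forall k, measurable (f @^-1` [set k]).
Proof.
move=> [P [[cP tP P0] borelP _]].
rewrite card_eq_sym => /card_set_bijP[g [gA ginj gsurj]].
have /choice[f fP] : forall r, exists k, A k /\ g k r.
  move=> r; have [B PB Br] : cover P id r by rewrite cP.
  by have [k Ak gk] := gsurj B PB; exists k; rewrite gk.
have fE r k : A k -> g k r -> f r = k.
  move=> Ak gkr; have [Af gfr] := fP r.
  apply: ginj; rewrite ?inE//; apply: tP; [exact: gA|exact: gA|by exists r].
exists f => [k Ak|k].
  by have [r gkr] := P0 _ (gA k Ak); exists r => //; exact: fE.
have [Ak|nAk] := pselect (A k); last first.
  rewrite (_ : _ @^-1` _ = set0) //.
  by apply/seteqP; split=> r // fk; apply: nAk; rewrite -fk; case: (fP r).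
rewrite (_ : _ @^-1` _ = g k).
  by rewrite -borel_sigma_algebraE; exact: borelP (gA k Ak).
by apply/seteqP; split=> [r <-|r]; [case: (fP r)|exact: fE].
Qed.

Lemma sp_Borel_preimage (R : realType) (X : Type) (g : R -> X)
    (P : set (set X)) :
  set_surj [set: R] [set: X] g -> partition P id [set: X] ->
  (forall A, P A -> measurable (g @^-1` A)) -> ~ countable P -> sp_Borel R P.
Proof.
move=> gsurj partP measP uncP.
have partgP := partition_preimage gsurj partP.
have cardgP := inj_card_eq (partition_inj partgP).
exists (preimage g @` P); split => //.
- exact: partition_image partgP.
- by move=> _ [A PA <-]; rewrite borel_sigma_algebraE; exact: measP.
- by rewrite (eq_countable cardgP).
Qed.

Lemma countable_bigcup_measurable d (T : measurableType d) (I : Type)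
    (D : set I) (F : I -> set T) :
  countable D -> (forall i, D i -> measurable (F i)) ->
  measurable (\bigcup_(i in D) F i).
Proof.
move=> cD mF; rewrite bigcup_set_type; apply: countable_bigcupT_measurable.
  by rewrite (eq_countable (card_setT _)).
by move=> i; apply: mF; exact: set_valP.
Qed.

Lemma nested_intervals (R : realType) (lo hi : nat -> R) :
  nondecreasing_seq lo -> nonincreasing_seq hi -> (forall k, lo k <= hi k) ->
  exists r, forall k, lo k <= r <= hi k.
Proof.
move=> lo_incr hi_decr le_lo_hi.
have lo_hi m n : lo m <= hi n.
  have [/lo_incr/le_trans|/ltnW/hi_decr] := leqP m n; first exact.
  exact: le_trans.
exists (sup (range lo)) => k; apply/andP; split.
  by apply: ub_le_sup; [exists (hi 0%N) => _ [n _ <-]|exists k].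
by apply: ge_sup => [|_ [n _ <-]//]; exists (lo 0%N), 0%N.
Qed.

Lemma measurable_preimage_floor (R : realType) (Z : set int) :
  measurable ((Num.floor : R -> int) @^-1` Z).
Proof.
have -> : Num.floor @^-1` Z =
    \bigcup_(z in Z) `[z%:~R, (z + 1)%:~R[%classic :> set R.
  apply/seteqP; split=> [r Zr|r [z Zz] /=].
    by exists (Num.floor r) => //=; rewrite in_itv/= floor_itv.
  by rewrite in_itv/= => /floor_def->.
exact: countable_bigcup_measurable.
Qed.

(* The hypothesis forces [1 < p]. Since the top digit [p - 1] is excluded, the
   expansion in base [p] is unambiguous. *)
Lemma floor_expansion (R : realType) (p : nat) (q : nat -> int) :
  (forall k, p%:Z * q k <= q k.+1 <= p%:Z * q k + p%:Z - 2) ->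
  exists r : R, forall k, Num.floor (p%:R ^+ k * r) = q k.
Proof.
move=> qP; have p0 : (0 : R) < p%:R by have := qP 0%N; rewrite ltr0n; lia.
pose lo k : R := (q k)%:~R / p%:R ^+ k.
pose hi k : R := (q k + 1)%:~R / p%:R ^+ k.
have loS k : lo k <= lo k.+1.
  rewrite ler_pdivlMr ?exprn_gt0// exprS mulrCA divfK ?expf_neq0 ?gt_eqF//.
  by have /andP[] := qP k; rewrite -(ler_int R) intrM.
have hiS k : hi k.+1 < hi k.
  rewrite ltr_pdivrMr ?exprn_gt0// exprS mulrCA divfK ?expf_neq0 ?gt_eqF//.
  rewrite pmulrn -intrM ltr_int; have /andP[_] := qP k; lia.
have [|||r rP] := @nested_intervals R lo hi.
- exact/nondecreasing_seqP.
- by apply/nonincreasing_seqP => k; exact: ltW.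
- by move=> k; rewrite ler_pM2r ?invr_gt0 ?exprn_gt0// ler_int lerDl.
exists r => k; apply: floor_def.
rewrite mulrC -ler_pdivrMr ?exprn_gt0// -ltr_pdivlMr ?exprn_gt0//.
have [/andP[-> _] /andP[_ rhi]] := (rP k, rP k.+1).
exact: le_lt_trans rhi (hiS k).
Qed.

Section borel_bits.
Context {R : realType} {I : countType}.

(* For a real with digits 0 and 1 in base 4, digit [k] is the parity of the
   integer part of [4 ^+ k * r]. *)
Definition real_bit (r : R) (i : I) : bool :=
  odd `|Num.floor (4 ^+ pickle i * r)|%N.

Lemma measurable_real_bit i : measurable_fun [set: R] (real_bit ^~ i).
Proof.
apply: (measurable_fun_bool true).
have oddM := @measurable_preimage_floor R [set z | odd `|z|%N].
exact: (mulrl_measurable (4 ^+ pickle i) measurableT oddM).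
Qed.

Lemma real_bit_surj : set_surj [set: R] [set: I -> bool] real_bit.
Proof.
move=> b _.
pose digit k := if unpickle k is Some i then b i else false.
pose q := fix q k : nat := (digit k + if k is j.+1 then 4 * q j else 0)%N.
have [|r rq] := @floor_expansion R 4 (fun k => (q k)%:Z).
  by move=> k /=; case: (digit k.+1); lia.
exists r => //; apply/funext => i; rewrite /real_bit rq absz_nat.
case: (pickle i) (pickleK i) => [|k] /= ik; rewrite oddD /digit ik.
  by rewrite oddb addbF.
by rewrite oddM oddb addbF.
Qed.

End borel_bits.

Definition real_of_cut (R : realType) (c : rat -> bool) : R :=
  fine (ereal_sup [set (ratr q)%:E | q in [set q | c q]]).

Lemma real_of_cutK (R : realType) (x : R) :
  real_of_cut R (fun q => ratr q < x) = x.
Proof.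
rewrite /real_of_cut; set S := image _ _; suff -> : ereal_sup S = x%:E by [].
apply/eqP; rewrite eq_le; apply/andP; split.
  by apply: ge_ereal_sup => _ [q /ltW qx <-].
apply/lee_subgt0Pr => e e0; rewrite -EFinB.
have [|q] := @rat_in_itvoo R (x - e) x; first by rewrite gtrBl.
rewrite in_itv/= => /andP[/ltW xq qx].
apply: (@le_trans _ _ (ratr q : R)%:E); first by rewrite lee_fin.
by apply: ereal_sup_ubound; exists q.
Qed.

Lemma measurable_real_of_cut d (T : measurableType d) (R : realType)
    (c : T -> rat -> bool) :
  (forall q, measurable_fun [set: T] (c ^~ q)) ->
  measurable_fun [set: T] (fun t => real_of_cut R (c t)).
Proof.
move=> mc; apply: measurableT_comp; first exact: fine_measurable.
apply: (measurability _ (ErealGenOInfty.measurableE R)).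
move=> _ [_ [x ->] <-]; rewrite setTI.
rewrite (_ : _ @^-1` _ =
    \bigcup_(q in [set q | x < ratr q]) c ^~ q @^-1` [set true]).
  apply: countable_bigcup_measurable => // q _.
  by rewrite -[X in measurable X]setTI; exact: mc.
apply/seteqP; split=> t /=; rewrite in_itv/= andbT.
  by move=> /ereal_sup_gt[_ [q cq <-] xq]; exists q; rewrite /= -?lte_fin.
move=> [q xq cq]; apply/ereal_sup_gtP.
by exists (ratr q)%:E; [exists q|rewrite lte_fin].
Qed.

(* Read the bits of [r] as the Dedekind cuts of countably many reals. *)
Definition real_sequence (R : realType) (r : R) (n : nat) : R :=
  real_of_cut R (fun q => real_bit r (n, q)).

Lemma measurable_real_sequence (R : realType) n :
  measurable_fun [set: R] (fun r : R => real_sequence r n).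
Proof. by apply: measurable_real_of_cut => q; exact: measurable_real_bit. Qed.

Lemma real_sequence_surj (R : realType) :
  set_surj [set: R] [set: nat -> R] (@real_sequence R).
Proof.
move=> x _; pose cuts nq : bool := ratr nq.2 < x nq.1.
have [r _ rcuts] := @real_bit_surj R (nat * rat)%type cuts I.
exists r => //; apply/funext => n; rewrite /real_sequence rcuts.
exact: (real_of_cutK (x n)).
Qed.

Lemma borel_surj_sequence (R : realType) (T : Type) (f : R -> T) :
  set_surj [set: R] [set: T] f ->
  (forall k, measurable (f @^-1` [set k])) ->
  exists2 psi : R -> nat -> T, set_surj [set: R] [set: nat -> T] psi &
    forall n k, measurable [set r | psi r n = k].
Proof.
move=> f_surj f_meas; exists (fun r n => f (real_sequence r n)) => [x _|n k].
  have /choice[s fs] : forall n, exists s, f s = x n.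
    by move=> n; have [s _ <-] := f_surj (x n) I; exists s.
  have [r _ rs] := @real_sequence_surj R s I; exists r => //.
  by apply/funext => n; rewrite rs.
rewrite -[X in measurable X]setTI.
exact: (measurable_real_sequence n measurableT (f_meas k)).
Qed.

Definition metric_ball (R : realType) (X : Type) (d : X -> X -> R) (x : X)
    (e : R) : set X := [set y | d x y < e].

Lemma exists_natSinv_lt (R : realType) (n : nat) (e : R) :
  0 < e -> exists2 m, (n <= m)%N & m.+1%:R^-1 < e.
Proof.
move=> e0; have [N _ Ne] := near_infty_natSinv_lt (PosNum e0).
by exists (maxn n N); [exact: leq_maxl|apply: Ne => /=; exact: leq_maxr].
Qed.

Section metric_balls.
Context {R : realType} {X : Type} {d : X -> X -> R}.
Hypothesis d_metric : is_metric d.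

Lemma metric_ge0 (x y : X) : 0 <= d x y.
Proof.
have [d0 dC dD] := d_metric.
by have := dD x y x; rewrite (d0 x x).2// (dC y) -mulr2n pmulrn_lge0.
Qed.

Lemma metric_ball_center (x : X) (e : R) : 0 < e -> metric_ball d x e x.
Proof. by have [d0 _ _] := d_metric; rewrite /metric_ball/= (d0 x x).2. Qed.

Lemma metric_ball_sym (x y : X) (e : R) :
  metric_ball d x e y -> metric_ball d y e x.
Proof. by have [_ dC _] := d_metric; rewrite /metric_ball/= dC. Qed.

Lemma metric_ball_triangle (x y z : X) (e1 e2 : R) :
  metric_ball d x e1 y -> metric_ball d y e2 z -> metric_ball d x (e1 + e2) z.
Proof.
have [_ _ dD] := d_metric => xy yz.
by apply: le_lt_trans (dD x y z) _; exact: ltrD.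
Qed.

Lemma metric_ball_split (x y z : X) (e : R) :
  metric_ball d x (e / 2) y -> metric_ball d y (e / 2) z -> metric_ball d x e z.
Proof.
by rewrite [e in X in _ -> _ -> X]splitr; exact: metric_ball_triangle.
Qed.

Lemma metric_ball_interior (x y : X) (e : R) : metric_ball d x e y ->
  exists2 r, 0 < r & metric_ball d y r `<=` metric_ball d x e.
Proof.
have [_ _ dD] := d_metric => xy; exists (e - d x y); first by rewrite subr_gt0.
move=> z; rewrite /metric_ball/= ltrBrDl; exact: le_lt_trans (dD x y z).
Qed.

Lemma metric_ball_eq (x y : X) :
  (forall e, 0 < e -> metric_ball d x e y) -> x = y.
Proof.
have [d0 _ _] := d_metric => xy; apply/d0/eqP; rewrite eq_le metric_ge0 andbT.
by apply/ler_addgt0Pl => e e0; rewrite addr0; exact/ltW/xy.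
Qed.

End metric_balls.

Lemma open_metric_ball (R : realType) (X : topologicalType) (d : X -> X -> R)
    (x : X) (e : R) :
  is_metric d -> metric_induces d -> open (metric_ball d x e).
Proof. by move=> dm dX; apply/dX => y; exact: metric_ball_interior. Qed.

Section polish_subspace.
Context {R : realType} {X : topologicalType} {A : set X}.
Variables (dX : X -> X -> R) (dA : A -> A -> R) (D : set A).
Hypotheses (dX_metric : is_metric dX) (dX_induces : metric_induces dX).
Hypotheses (dA_metric : is_metric dA) (dA_induces : metric_induces dA).
Hypotheses (dA_complete : metric_complete dA) (D_dense : dense D).

Definition trace_ball (x : X) (e : R) : set A :=
  [set y | metric_ball dX x e (\val y)].

Lemma open_trace_ball x e : open (trace_ball x e).
Proof. by exists (metric_ball dX x e) => //; exact: open_metric_ball. Qed.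

Lemma trace_ball_sub (x : A) (e : R) : 0 < e ->
  exists2 r, 0 < r & trace_ball (\val x) r `<=` metric_ball dA x e.
Proof.
move=> e0; have [V oV VE] := open_metric_ball x e dA_metric dA_induces.
have Vx : (\val @^-1` V) x by rewrite VE; exact: metric_ball_center.
have [r r0 rV] := (dX_induces V).1 oV (\val x) Vx.
by exists r => // y /rV; rewrite -VE.
Qed.

(* The bound [n <= m] makes the centres of small balls around a point of [X],
   one for each [n], converge to that point. *)
Definition small_ball (n : nat) (y : A) (m : nat) : Prop :=
  (n <= m)%N /\ forall z w, trace_ball (\val y) m.+1%:R^-1 z ->
    trace_ball (\val y) m.+1%:R^-1 w -> metric_ball dA z n.+1%:R^-1 w.

Lemma small_ball_cover (n : nat) (x : A) :
  exists p : A * nat, [/\ D p.1, small_ball n p.1 p.2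
    & metric_ball dX (\val p.1) p.2.+1%:R^-1 (\val x)].
Proof.
have [|r r0 rx] := trace_ball_sub x (e := n.+1%:R^-1 / 2).
  by rewrite divr_gt0.
have [|m nm mr] := exists_natSinv_lt n (e := r / 2); first by rewrite divr_gt0.
have [||y [xy Dy]] := @D_dense (trace_ball (\val x) m.+1%:R^-1).
- by exists x; exact: metric_ball_center.
- exact: open_trace_ball.
exists (y, m); split => //=; last exact: metric_ball_sym.
have near_x z : trace_ball (\val y) m.+1%:R^-1 z ->
    metric_ball dA x (n.+1%:R^-1 / 2) z.
  move=> yz; apply: rx; apply: (metric_ball_split dX_metric (y := \val y)).
    exact: lt_trans xy mr.
  exact: lt_trans yz mr.
split=> // z w /near_x xz /near_x; apply: metric_ball_split => //.
exact: metric_ball_sym.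
Qed.

Lemma mem_small_balls (x : X) :
  (forall n, exists p : A * nat, small_ball n p.1 p.2 /\
    metric_ball dX (\val p.1) p.2.+1%:R^-1 x) -> A x.
Proof.
move=> /choice[p /all_and2[p_small xp]]; pose u n := (p n).1.
have u_near_x e : 0 < e ->
    exists N, forall n, (N <= n)%N -> metric_ball dX x e (\val (u n)).
  move=> e0; have [N _ NP] := near_infty_natSinv_lt (PosNum e0).
  exists N => n Nn; apply: metric_ball_sym => //; apply: lt_trans (xp n) _.
  by apply: NP => /=; apply: leq_trans Nn _; case: (p_small n).
have u_cauchy : metric_cauchy_seq dA u.
  move=> e e0; have [n _ ne] := exists_natSinv_lt 0 e0.
  have [_ small] := p_small n.
  have [r r0 rp] := metric_ball_interior dX_metric (xp n).
  have [N Nu] := u_near_x r r0.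
  exists N => i j Ni Nj; apply: lt_trans ne.
  by apply: small; apply: rp; exact: Nu.
have [a ua] := dA_complete u_cauchy.
suff -> : x = \val a by exact: set_valP.
apply: (metric_ball_eq dX_metric) => e e0.
have e20 : 0 < e / 2 by rewrite divr_gt0.
have [r r0 ra] := (dA_induces _).1 (open_trace_ball (\val a) (e / 2)) a
  (metric_ball_center dX_metric _ e20).
have [[N Nu] [M Ma]] := (u_near_x _ e20, ua r r0).
apply: (metric_ball_split dX_metric (y := \val (u (maxn N M)))).
  by apply: Nu; exact: leq_maxl.
apply: metric_ball_sym => //; apply: ra; apply: metric_ball_sym => //.
by apply: Ma; exact: leq_maxr.
Qed.

End polish_subspace.

(* Alexandrov's theorem that completely metrizable subspaces are G_delta, where
   separability makes the open sets countable unions of balls. *)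
Lemma polish_subspace_bigcap_bigcup (R : realType) (X : topologicalType)
    (d : X -> X -> R) (A : set X) :
  is_metric d -> metric_induces d -> polish_space R A ->
  exists2 B : nat -> set (X * nat), (forall n, countable (B n)) &
    A = \bigcap_n \bigcup_(p in B n) metric_ball d p.1 p.2.+1%:R^-1.
Proof.
move=> d_metric d_induces [[D cD dD] [dA [dA_metric dA_induces dA_complete]]].
pose pairs n := [set p | D p.1 /\ small_ball d dA n p.1 p.2].
exists (fun n => [set (\val p.1, p.2) | p in pairs n]) => [n|].
  have cDN : countable (D `*` [set: nat]) by exact: countableX.
  apply: sub_countable (card_image_le _ _) _; apply: sub_countable cDN.
  by apply: subset_card_le => p [].
apply/seteqP; split=> [x Ax n _|x xB].
  have [p [Dp np px]] := small_ball_cover d_metric d_induces dA_metric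
    dA_induces dD n (exist _ x (mem_set Ax)).
  by exists (\val p.1, p.2) => //; exists p.
apply: (mem_small_balls d_metric d_induces dA_metric dA_induces dA_complete).
by move=> n; have [_ [p [_ np] <-] px] := xB n I; exists p.
Qed.

Definition first_diff_dist (R : realType) (T : nat -> eqType)
    (x y : forall n, T n) : R :=
  sup (range (fun n => (x n != y n)%:R / n.+1%:R)).

Definition cylinder (T : nat -> eqType) (x : forall n, T n) (m : nat) :
  set (forall n, T n) := [set y | forall i, (i <= m)%N -> y i = x i].

Section first_diff_dist.
Context {R : realType} {T : nat -> eqType}.
Implicit Types x y z : forall n, T n.
Local Notation dist := (@first_diff_dist R T).

Lemma first_diff_dist_ge x y n : (x n != y n)%:R / n.+1%:R <= dist x y.
Proof.
apply: ub_le_sup; last by exists n.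
exists 1 => _ [i _ <-]; rewrite ler_pdivrMr// mul1r ler_nat.
exact: leq_trans (leq_b1 _) _.
Qed.

Lemma first_diff_dist_le x y (e : R) :
  (forall n, (x n != y n)%:R / n.+1%:R <= e) -> dist x y <= e.
Proof.
move=> xye; apply: ge_sup => [|_ [n _ <-]//].
by apply: image_nonempty; exists 0%N.
Qed.

Lemma first_diff_dist_eq0 x y : dist x y = 0 <-> x = y.
Proof.
split=> [xy0|->].
  apply: functional_extensionality_dep => n; apply/eqP.
  have := first_diff_dist_ge x y n; rewrite xy0; case: eqP => // _.
  by rewrite leNgt divr_gt0.
apply/eqP; rewrite eq_le; apply/andP; split.
  by apply: first_diff_dist_le => n; rewrite eqxx mul0r.
by apply: le_trans (first_diff_dist_ge y y 0); rewrite divr_ge0.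
Qed.

Lemma first_diff_dist_metric : is_metric dist.
Proof.
split=> [||x y z]; first exact: first_diff_dist_eq0.
  by move=> x y; congr sup; apply: eq_imagel => n _; rewrite eq_sym.
apply: first_diff_dist_le => n.
apply: le_trans (lerD (first_diff_dist_ge x y n) (first_diff_dist_ge y z n)).
rewrite -mulrDl ler_pM2r ?invr_gt0// -natrD ler_nat.
by have [->//|_] := eqVneq (x n) (y n); case: (x n != z n).
Qed.

Lemma metric_ball_first_diff x m :
  metric_ball dist x m.+1%:R^-1 = cylinder x m.
Proof.
apply/seteqP; split=> y /= xy.
  move=> i im; apply/eqP/negPn/negP; rewrite eq_sym => xyi.
  have := le_lt_trans (first_diff_dist_ge x y i) xy.
  by rewrite xyi mul1r ltf_pV2 ?posrE// ltr_nat ltnNge ltnS im.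
apply: (@le_lt_trans _ _ m.+2%:R^-1); last by rewrite ltf_pV2 ?posrE// ltr_nat.
apply: first_diff_dist_le => n; have [/xy->|mn] := leqP n m.
  by rewrite eqxx mul0r invr_ge0.
apply: (@le_trans _ _ n.+1%:R^-1); last by rewrite lef_pV2 ?posrE// ler_nat.
by rewrite ler_piMl ?invr_ge0// lern1 leq_b1.
Qed.

End first_diff_dist.
Arguments metric_ball_first_diff R {T}.

Section product_of_discrete.
Context {T : nat -> discreteTopologicalType}.

Lemma nbhs_cylinder (x : prod_topology T) m : nbhs x (cylinder x m).
Proof.
have near_x (i : 'I_m.+1) : nbhs x [set y : prod_topology T | y i = x i].
  exact: (@proj_continuous _ T i x _ (discrete_set1 _)).
apply: filterS (filter_forall _ near_x) => y yx i.
by rewrite -ltnS => im; exact: (yx (Ordinal im)).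
Qed.

Lemma cylinder_basis (x : prod_topology T) (U : set (prod_topology T)) :
  nbhs x U -> exists m, cylinder x m `<=` U.
Proof.
pose F : set_system (prod_topology T) := filter_from [set: nat] (cylinder x).
have F_filter : Filter F.
  apply: filter_from_filter; first by exists 0%N.
  move=> m n _ _; exists (maxn m n) => // y xy.
  by split=> i im; apply: xy; rewrite leq_max im ?orbT.
suff : F --> x by move=> /[apply] -[m _ mU]; exists m.
apply/cvg_sup => i A [_ [[V oV <-] Vx VA]].
by exists i => // y xy; apply: VA => /=; rewrite xy.
Qed.

Lemma first_diff_dist_induces (R : realType) :
  metric_induces (X := prod_topology T) (@first_diff_dist R T).
Proof.
move=> U; split=> [oU x Ux|ballU].
  have [m mU] := cylinder_basis (open_nbhs_nbhs (conj oU Ux)).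
  by exists m.+1%:R^-1 => //; move: mU; rewrite -(metric_ball_first_diff R).
rewrite openE => x /ballU[e e0 eU].
have [m _ me] := exists_natSinv_lt 0 e0.
apply: (filterS (Filter := nbhs_filter x)) (nbhs_cylinder x m) => y.
have <- := metric_ball_first_diff R x m.
by move=> /lt_trans/(_ me); exact: eU.
Qed.

Lemma measurable_preimage_polish (R : realType) d (Omega : measurableType d)
    (f : Omega -> prod_topology T) (A : set (prod_topology T)) :
  (forall n k, measurable [set w | f w n = k]) ->
  polish_space R A -> measurable (f @^-1` A).
Proof.
move=> f_meas A_polish.
have cyl_meas x m : measurable (f @^-1` cylinder x m).
  rewrite (_ : _ @^-1` _ = \bigcap_(i in `I_m.+1) [set w | f w i = x i]).
    by apply: bigcap_measurableType => i _; exact: f_meas.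
  by apply/seteqP; split=> w fw i /fw.
have [B cB ->] := polish_subspace_bigcap_bigcup (X := prod_topology T)
  first_diff_dist_metric (first_diff_dist_induces R) A_polish.
rewrite preimage_bigcap; apply: bigcap_measurableType => n _.
rewrite preimage_bigcup; apply: countable_bigcup_measurable => // p _.
by rewrite metric_ball_first_diff.
Qed.

End product_of_discrete.

Lemma separable_cover (X : topologicalType) (P : set (set X)) :
  countable P -> cover P id = [set: X] ->
  (forall A : set X, P A -> separable_space A) -> separable_space X.
Proof.
move=> cP covP sepP.
have /choice[C CP] : forall A, exists C : set X, P A ->
    countable C /\ forall U, open U -> U `&` A !=set0 -> U `&` C !=set0.
  move=> A; have [/sepP[D cD dD]|] := pselect (P A); last by exists set0.
  exists (\val @` D) => _; split=> [|U oU [x [Ux Ax]]].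
    exact: sub_countable (card_image_le _ _) cD.
  have [||y [Uy Dy]] := dD (\val @^-1` U).
  - by exists (exist _ x (mem_set Ax)).
  - by exists U.
  by exists (\val y); split => //; exists y.
exists (\bigcup_(A in P) C A); first by apply: bigcup_countable => // A /CP[].
move=> U [x Ux] oU; have [A PA Ax] : cover P id x by rewrite covP.
have [|y [Uy Cy]] := (CP A PA).2 U oU; first by exists x.
by exists y; split => //; exists A.
Qed.

Lemma separable_image (X Y : topologicalType) (f : X -> Y) :
  continuous f -> set_surj [set: X] [set: Y] f -> separable_space X ->
  separable_space Y.
Proof.
move=> f_cont f_surj [D cD dD]; exists (f @` D).
  exact: sub_countable (card_image_le _ _) cD.
move=> U [y Uy] oU; have [x _ fxy] := f_surj y I.
have [||z [Uz Dz]] := dD (f @^-1` U).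
- by exists x; rewrite /= fxy.
- exact: (continuousP _).1.
by exists (f z); split => //; exists z.
Qed.

Lemma separable_discrete (T : discreteTopologicalType) :
  separable_space T -> countable [set: T].
Proof.
move=> [D cD dD]; apply: sub_countable cD; apply: subset_card_le => x _.
by have [||_ [-> Dx]] := dD [set x]; [exists x|exact: discrete_open|].
Qed.

Lemma polish_partition_uncountable (R : realType) (K : discreteTopologicalType)
    (P : set (set {ptws nat -> K})) :
  ~ countable [set: K] -> polish_partition R P -> ~ countable P.
Proof.
move=> uncK [[covP _ _] polP] cP; apply/uncK/separable_discrete.
apply: (@separable_image {ptws nat -> K} K (proj 0%N)).
- exact: proj_continuous.
- by move=> k _; exists (fun=> k).
- by apply: separable_cover cP covP _ => A /polP[].
Qed.

Theorem theorem4p3 (R : realType) (K : choiceType) :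
  ~ countable [set: K] ->
  sp_Borel R [set: K] ->
  sp_Borel R (par R (prod_topology (fun _ : nat => discrete_topology K))).
Proof.
move=> uncK /sp_Borel_surj[f f_surj f_meas].
have [psi psi_surj psi_meas] := borel_surj_sequence f_surj f_meas.
have [par_polish _] := parP R {ptws nat -> discrete_topology K}.
apply: (sp_Borel_preimage psi_surj par_polish.1) => [A PA|].
  exact: (measurable_preimage_polish (T := fun=> discrete_topology K) psi_meas
    (par_polish.2 A PA)).
exact: (@polish_partition_uncountable R (discrete_topology K)).
Qed.
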